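(* Let $F_A$, $G_A$ and $H_A$ be three interval-valued hesitant fuzzy soft sets over $(U,E)$ with the same nonempty parameter set $A\subseteq E$. Then: (i) $F_A\tilde{\cup}G_A=G_A\tilde{\cup}F_A$; (ii) $F_A\tilde{\cap}G_A=G_A\tilde{\cap}F_A$; (iii) $F_A\tilde{\cup}(G_A\tilde{\cup}H_A)=(F_A\tilde{\cup}G_A)\tilde{\cup}H_A$; (iv) $F_A\tilde{\cap}(G_A\tilde{\cap}H_A)=(F_A\tilde{\cap}G_A)\tilde{\cap}H_A$.
   Context: $U$ is an initial universe and $E$ a set of parameters. An interval-valued hesitant fuzzy element (IVHFE) is a nonempty set of closed intervals $\gamma=[\gamma^L,\gamma^U]\subseteq[0,1]$. For IVHFEs $\mu_1,\mu_2$: $\mu_1\cup\mu_2=\{[\max(\gamma_1^L,\gamma_2^L),\max(\gamma_1^U,\gamma_2^U)]:\gamma_1\in\mu_1,\gamma_2\in\mu_2\}$ and $\mu_1\cap\mu_2=\{[\min(\gamma_1^L,\gamma_2^L),\min(\gamma_1^U,\gamma_2^U)]:\gamma_1\in\mu_1,\gamma_2\in\mu_2\}$. An interval-valued hesitant fuzzy soft set $F_A$ over $(U,E)$, with $A\subseteq E$, assigns to each $e\in A$ and each $h\in U$ an IVHFE $\mu_{F(e)}(h)$. Two such sets are equal when they have the same parameter set and the same IVHFE for every $e$ and $h$. For two interval-valued hesitant fuzzy soft sets with the same parameter set $A$, $F_A\tilde\cup G_A$ and $F_A\tilde\cap G_A$ have parameter set $A$ and values $\mu_{F(e)}(h)\cup\mu_{G(e)}(h)$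 and $\mu_{F(e)}(h)\cap\mu_{G(e)}(h)$ respectively, for all $e\in A$, $h\in U$. *)

(* Defs.v *)
From HB Require Import structures.
From mathcomp Require Import all_boot all_order all_algebra.
From mathcomp Require Import boolp classical_sets reals.
Set Implicit Arguments.
Unset Strict Implicit.
Unset Printing Implicit Defensive.
Import Order.TTheory GRing.Theory Num.Theory.
Local Open Scope classical_set_scope.
Local Open Scope ring_scope.

(* A closed interval [lo, up] inside [0, 1], given by its endpoints;
   degenerate intervals (lo = up) are allowed. *)
Record cinterval (R : realType) := CInterval {
  lo : R;
  up : R;
  lo_ge0 : 0 <= lo;
  lo_le_up : lo <= up;
  up_le1 : up <= 1 }.

Section cinterval_ops.
Variable R : realType.
Implicit Types g : cinterval R.

Lemma cinterval_eq g1 g2 : lo g1 = lo g2 -> up g1 = up g2 -> g1 = g2.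
Proof.
case: g1 g2 => [l1 u1 a1 b1 c1] [l2 u2 a2 b2 c2] /= El Eu.
by subst; congr CInterval; exact: Prop_irrelevance.
Qed.

Fact cmax_ge0 g1 g2 : 0 <= Num.max (lo g1) (lo g2).
Proof. by rewrite le_max lo_ge0. Qed.

Fact cmax_le g1 g2 : Num.max (lo g1) (lo g2) <= Num.max (up g1) (up g2).
Proof. by rewrite ge_max !le_max !lo_le_up orbT. Qed.

Fact cmax_le1 g1 g2 : Num.max (up g1) (up g2) <= 1.
Proof. by rewrite ge_max !up_le1. Qed.

Definition cmax g1 g2 : cinterval R :=
  CInterval (cmax_ge0 g1 g2) (cmax_le g1 g2) (cmax_le1 g1 g2).

Fact cmin_ge0 g1 g2 : 0 <= Num.min (lo g1) (lo g2).
Proof. by rewrite le_min !lo_ge0. Qed.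

Fact cmin_le g1 g2 : Num.min (lo g1) (lo g2) <= Num.min (up g1) (up g2).
Proof. by rewrite le_min !ge_min !lo_le_up orbT. Qed.

Fact cmin_le1 g1 g2 : Num.min (up g1) (up g2) <= 1.
Proof. by rewrite ge_min up_le1. Qed.

Definition cmin g1 g2 : cinterval R :=
  CInterval (cmin_ge0 g1 g2) (cmin_le g1 g2) (cmin_le1 g1 g2).

End cinterval_ops.

(* Interval-valued hesitant fuzzy elements. *)
Record ivhfe (R : realType) := IVHFE {
  ivals : set (cinterval R);
  ivals_nonempty : ivals !=set0 }.

Section ivhfe_ops.
Variable R : realType.
Implicit Types m : ivhfe R.

Lemma ivhfe_eq m1 m2 : ivals m1 = ivals m2 -> m1 = m2.
Proof.
case: m1 m2 => [s1 n1] [s2 n2] /= E.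
by subst; congr IVHFE; exact: Prop_irrelevance.
Qed.

Fact ivhfe_union_nonempty m1 m2 :
  [set cmax g1 g2 | g1 in ivals m1 & g2 in ivals m2] !=set0.
Proof.
have [g1 g1m] := ivals_nonempty m1; have [g2 g2m] := ivals_nonempty m2.
by exists (cmax g1 g2), g1 => //; exists g2.
Qed.

Definition ivhfe_union m1 m2 : ivhfe R := IVHFE (ivhfe_union_nonempty m1 m2).

Fact ivhfe_inter_nonempty m1 m2 :
  [set cmin g1 g2 | g1 in ivals m1 & g2 in ivals m2] !=set0.
Proof.
have [g1 g1m] := ivals_nonempty m1; have [g2 g2m] := ivals_nonempty m2.
by exists (cmin g1 g2), g1 => //; exists g2.
Qed.

Definition ivhfe_inter m1 m2 : ivhfe R := IVHFE (ivhfe_inter_nonempty m1 m2).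

End ivhfe_ops.

(* Interval-valued hesitant fuzzy soft sets over (U, E) with parameter set A:
   F e h is the element mu_{F(e)}(h).  The domain is the subtype of the
   parameters in A, so F has no values outside A, and equality in this type is
   equality of all the mu_{F(e)}(h) (lemma ivhfss_eqP). *)
Definition ivhfss (R : realType) (U E : Type) (A : set E) : Type :=
  A -> U -> ivhfe R.

Section ivhfss_ops.
Variables (R : realType) (U E : Type) (A : set E).
Implicit Types F G : ivhfss R U A.

Lemma ivhfss_eqP F G :
  F = G <-> forall (e : A) (h : U), ivals (F e h) = ivals (G e h).
Proof.
split=> [-> //|FG]; apply/funext => e; apply/funext => h.
exact/ivhfe_eq/FG.
Qed.

Definition ivhfss_union F G : ivhfss R U A :=
  fun e h => ivhfe_union (F e h) (G e h).

Definition ivhfss_inter F G : ivhfss R U A :=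
  fun e h => ivhfe_inter (F e h) (G e h).

End ivhfss_ops.

(* Main.v *)
Require Import Defs.
From mathcomp Require Import all_boot all_order all_algebra.
From mathcomp Require Import boolp classical_sets reals.
Import Order.TTheory.
Local Open Scope classical_set_scope.

(** The endpoints of intervals are combined by [Num.max] or [Num.min], which
    are commutative and associative on a total order, so [cmax] and [cmin] are
    commutative and associative operations on closed intervals. These laws
    pass to the elementwise lifting of an operation to sets ([image2_comm],
    [image2_assoc]), hence to interval-valued hesitant fuzzy elements, and then
    to soft sets, whose operations and equality are pointwise. *)

Lemma cmaxC (R : realType) : commutative (@cmax R).
Proof. by move=> g1 g2; apply: cinterval_eq; exact: maxC. Qed.

Lemma cmaxA (R : realType) : associative (@cmax R).
Proof. by move=> g1 g2 g3; apply: cinterval_eq; exact: maxA. Qed.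

Lemma cminC (R : realType) : commutative (@cmin R).
Proof. by move=> g1 g2; apply: cinterval_eq; exact: minC. Qed.

Lemma cminA (R : realType) : associative (@cmin R).
Proof. by move=> g1 g2 g3; apply: cinterval_eq; exact: minA. Qed.

Lemma image2_comm (T : Type) (op : T -> T -> T) (X Y : set T) :
  commutative op ->
  [set op x y | x in X & y in Y] = [set op y x | y in Y & x in X].
Proof.
move=> opC; apply/seteqP.
by split=> _ [x Xx [y Yy <-]]; exists y => //; exists x => //; rewrite opC.
Qed.

Lemma image2_assoc (T : Type) (op : T -> T -> T) (X Y Z : set T) :
  associative op ->
  [set op x t | x in X & t in [set op y z | y in Y & z in Z]] =
  [set op t z | t in [set op x y | x in X & y in Y] & z in Z].
Proof.
move=> opA; apply/seteqP; split=> w.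
- move=> [x Xx [t [y Yy [z Zz <-]] <-]].
  exists (op x y); first by exists x => //; exists y.
  by exists z => //; rewrite opA.
- move=> [_ [x Xx [y Yy <-]] [z Zz <-]].
  exists x => //; exists (op y z); first by exists y => //; exists z.
  by rewrite opA.
Qed.

Theorem proposition3p9 (R : realType) (U E : Type) (A : set E)
    (hA : A !=set0) (F G H : ivhfss R U A) :
  [/\ ivhfss_union F G = ivhfss_union G F,
      ivhfss_inter F G = ivhfss_inter G F,
      ivhfss_union F (ivhfss_union G H) = ivhfss_union (ivhfss_union F G) H
    & ivhfss_inter F (ivhfss_inter G H) = ivhfss_inter (ivhfss_inter F G) H].
Proof.
split; apply/ivhfss_eqP => e h.
- by apply: image2_comm; exact: cmaxC.
- by apply: image2_comm; exact: cminC.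
- by apply: image2_assoc; exact: cmaxA.
- by apply: image2_assoc; exact: cminA.
Qed.
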